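(* For the urn model $M$ with parameters $m,c$ and initial composition $(W_0,B_0)$ described in the context, the $s$-th moment of the number $W_n$ of white balls after $n$ draws is, for every integer $s\ge 1$ and every $n\ge 0$, given by $$\mathbb{E}(W_n^s)=\left(\prod_{j=0}^{n-1}\alpha_{j,s}\right)\left(W_0^s+\sum_{\ell=0}^{n-1}\frac{\beta_{\ell,s}}{\prod_{j=0}^{\ell}\alpha_{j,s}}\right),$$ where $$\alpha_{n,s}=\sum_{\ell=0}^{s}c^\ell\,\frac{\binom{s}{\ell}\binom{m}{\ell}}{\binom{T_n}{\ell}},$$ $$\beta_{n,s}=\sum_{i=2}^{s}\mathbb{E}(W_n^{s+1-i})\sum_{\ell=i}^{s}\binom{s}{\ell}c^\ell\sum_{j=\ell+1-i}^{\ell}(-1)^{j+i-1-\ell}\,\frac{S(\ell,j)\,c(j,\ell+1-i)\,\binom{m}{j}}{\binom{T_n}{j}}.$$ Here $S(n,k)$ denotes a Stirling number of the second kind and $c(n,k)$ (with two arguments) an unsigned Stirling number of the first kind.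
   Context: Urn model $M$: let $m\ge 1$ and $c\ge 1$ be integers. An urn initially contains $W_0$ white and $B_0$ black balls, where $W_0,B_0$ are integers with $W_0>0$, $B_0>0$, and $T_0=W_0+B_0\ge m$. At each discrete time step $m$ balls are drawn uniformly at random without replacement from the urn. If $m-\ell$ white balls and $\ell$ black balls have been drawn ($0\le\ell\le m$), the drawn balls are returned to the urn together with $c(m-\ell)$ additional white balls and $c\ell$ additional black balls. $W_n$ and $B_n$ denote the numbers of white and black balls after $n$ draws; the total is $T_n=W_n+B_n=T_0+nmc$. Thus, given the first $n-1$ draws, the probability that the $n$-th sample has exactly $k$ white balls is $\binom{W_{n-1}}{k}\binom{T_{n-1}-W_{n-1}}{m-k}/\binom{T_{n-1}}{m}$, $0\le k\le m$, and then $W_n=W_{n-1}+kc$. Conventions: a quotient $\binom{m}{\ell}/\binom{T_n}{\ell}$ with $\ell>m$ is read as $0$ (also when $\ell>T_n$); empty sums are $0$ and empty products are $1$ (in particular $\beta_{n,1}=0$). The letter $c$ without arguments is the urn parameter. *)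

(* Defs.v *)
From HB Require Import structures.
From mathcomp Require Export all_boot all_order all_algebra.
From mathcomp Require Export all_classical all_reals all_analysis.

Set Implicit Arguments.
Unset Strict Implicit.
Unset Printing Implicit Defensive.

Import Order.TTheory GRing.Theory Num.Theory.

Local Open Scope classical_set_scope.
Local Open Scope ring_scope.

Fixpoint stirling2 (n k : nat) : nat :=
  match n, k with
  | 0, 0 => 1
  | n'.+1, k'.+1 => (k * stirling2 n' k + stirling2 n' k')%N
  | _, _ => 0
  end.

(* Unsigned: the number of permutations of n letters with k cycles. *)
Fixpoint stirling1 (n k : nat) : nat :=
  match n, k with
  | 0, 0 => 1
  | n'.+1, k'.+1 => (n' * stirling1 n' k + stirling1 n' k')%N
  | _, _ => 0
  end.

(* Only meaningful when B is not P-null. *)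
Definition cond_prob d (T : measurableType d) (R : realType)
    (P : probability T R) (A B : set T) : R :=
  fine (P (A `&` B)) / fine (P B).

Definition moment d (T : measurableType d) (R : realType)
    (P : probability T R) (X : T -> nat) (s : nat) : \bar R :=
  'E_P[(fun t => (X t)%:R ^+ s)%R]%E.

(* In the next two counts, h i is the number of white balls in the sample
   drawn at time i + 1; the contents are those after n draws. *)
Definition white (c W0 : nat) (h : nat -> nat) (n : nat) : nat :=
  (W0 + \sum_(i < n) c * h i)%N.

Definition black (m c B0 : nat) (h : nat -> nat) (n : nat) : nat :=
  (B0 + \sum_(i < n) c * (m - h i))%N.

Definition total (m c W0 B0 n : nat) : nat := (W0 + B0 + n * m * c)%N.

Definition history (T : Type) (K : nat -> T -> nat) (n : nat)
    (h : nat -> nat) : set T :=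
  [set t | forall i, (i < n)%N -> K i t = h i].

(* The probability of k white balls in a uniform sample of m balls without
   replacement from w white and b black ones (for k <= m: beyond that, the
   truncated m - k would give a wrong value). *)
Definition hypergeometric (R : realType) (m w b k : nat) : R :=
  ('C(w, k) * 'C(b, m - k))%:R / 'C(w + b, m)%:R.

(* K i is the number of white balls in the sample drawn at time i + 1. *)
Definition urn_process d (T : measurableType d) (R : realType)
    (P : probability T R) (m c W0 B0 : nat) (K : nat -> {RV P >-> nat}) : Prop :=
  (forall i t, (K i t <= m)%N) /\
  (forall (n : nat) (h : nat -> nat) (k : nat), (k <= m)%N ->
     P (history K n h) != 0%E ->
     cond_prob P [set t | K n t = k] (history K n h) =
     hypergeometric R m (white c W0 h n) (black m c B0 h n) k).

Definition white_after d (T : measurableType d) (R : realType)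
    (P : probability T R) (c W0 : nat) (K : nat -> {RV P >-> nat}) (n : nat)
    (t : T) : nat :=
  white c W0 (fun i => K i t) n.

(* The convention that 'C(m, l) / 'C(T_n, l) is 0 for l > m holds because
   'C(m, l) = 0 then, including when the denominator vanishes, as 0 / 0 = 0. *)
Definition alpha (R : realType) (m c W0 B0 n s : nat) : R :=
  \sum_(0 <= l < s.+1)
    c%:R ^+ l * ('C(s, l) * 'C(m, l))%:R / 'C(total m c W0 B0 n, l)%:R.

(* In the range of summation j + i >= l + 1, so the subtractions of natural
   numbers are not truncated. *)
Definition beta d (T : measurableType d) (R : realType) (P : probability T R)
    (m c W0 B0 : nat) (K : nat -> {RV P >-> nat}) (n s : nat) : R :=
  \sum_(2 <= i < s.+1)
    fine (moment P (white_after c W0 K n) (s + 1 - i)) *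
    \sum_(i <= l < s.+1) 'C(s, l)%:R * c%:R ^+ l *
      \sum_(l + 1 - i <= j < l.+1)
        (-1) ^+ (j + i - 1 - l) *
        ((stirling2 l j * stirling1 j (l + 1 - i) * 'C(m, j))%:R /
         'C(total m c W0 B0 n, j)%:R).

(* Main.v *)
(* Given the composition (w, b) of the urn, the number k of white balls in the
   sample is hypergeometric, with factorial moments
     E(k ^_ j) = w ^_ j * 'C(m, j) / 'C(w + b, j).
   Expand (w + c k)^s by the binomial theorem, the powers of k into falling
   factorials with Stirling numbers of the second kind, and the resulting
   w ^_ j back into powers of w with those of the first kind.  The coefficient
   of w^s is alpha, the other ones add up to beta after averaging over w, so
   E(W_(n+1)^s) = alpha_(n,s) E(W_n^s) + beta_(n,s), a linear recurrence with
   alpha_(n,s) > 0 which is then unrolled. *)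

Require Import Defs.
From mathcomp Require Import zify ring measurable_realfun.
Import Order.TTheory GRing.Theory Num.Theory.
Set Implicit Arguments. Unset Strict Implicit. Unset Printing Implicit Defensive.
Local Open Scope ring_scope.

(** * Stirling numbers and falling factorials *)

Lemma stirling1_small (n k : nat) : (n < k)%N -> stirling1 n k = 0%N.
Proof.
by elim: n k => [|n IHn] [|k] //= nk; rewrite !IHn ?muln0// ltnW.
Qed.

Lemma stirling2_small (n k : nat) : (n < k)%N -> stirling2 n k = 0%N.
Proof.
by elim: n k => [|n IHn] [|k] //= nk; rewrite !IHn ?muln0// ltnW.
Qed.

Lemma stirling1nn (n : nat) : stirling1 n n = 1%N.
Proof. by elim: n => //= n ->; rewrite stirling1_small// muln0. Qed.

Lemma stirling2nn (n : nat) : stirling2 n n = 1%N.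
Proof. by elim: n => //= n ->; rewrite stirling2_small// muln0. Qed.

(** Induction on [n]: the identity [step] reproduces the recurrence of [stirling2]. *)
Lemma expn_stirling2 (x n : nat) :
  (x ^ n = \sum_(0 <= j < n.+1) stirling2 n j * x ^_ j)%N.
Proof.
elim: n => [|n IHn]; first by rewrite big_nat1 mul1n.
have step j : (x * x ^_ j = j * x ^_ j + x ^_ j.+1)%N.
  have [jx|xj] := leqP j x; last by rewrite !ffact_small ?muln0// ltnW.
  by rewrite ffactnSr (mulnC _ (x - j)%N) -mulnDl subnKC.
rewrite expnS IHn big_distrr /= [RHS]big_nat_recl//= mul0n add0n.
under eq_bigr do rewrite mulnCA step mulnDr.
under [RHS]eq_bigr do rewrite mulnDl.
rewrite !big_split /= addnC [RHS]addnC; congr addn.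
rewrite big_nat_recl//= mul0n muln0 add0n [RHS]big_nat_recr//=.
rewrite stirling2_small// muln0 mul0n addn0.
by apply: eq_bigr => i _; rewrite mulnCA mulnA.
Qed.

Lemma ffact_stirling1 (R : comPzRingType) (x n : nat) :
  (x ^_ n)%:R =
  \sum_(0 <= p < n.+1) (-1) ^+ (n - p) * (stirling1 n p)%:R * x%:R ^+ p :> R.
Proof.
elim: n => [|n IHn]; first by rewrite big_nat1 !mul1r.
(* This is x^_(n+1) = (x - n) x^_n with a true subtraction; when x < n both falling factorials
   vanish. *)
have -> : (x ^_ n.+1)%:R = x%:R * (x ^_ n)%:R - n%:R * (x ^_ n)%:R :> R.
  have [nx|xn] := leqP n x; last by rewrite !ffact_small ?mulr0 ?subr0// ltnW.
  by rewrite -mulrBl -natrB// -natrM mulnC -ffactnSr.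
rewrite IHn [RHS]big_nat_recl//= mulr0 mul0r add0r.
under [RHS]eq_bigr do rewrite subSS natrD mulrDr mulrDl.
rewrite [RHS]big_split /= addrC; congr (_ + _).
  by rewrite mulr_sumr; apply: eq_bigr => p _; rewrite exprS; ring.
rewrite [X in _ = X]big_nat_recr//= stirling1_small// muln0 mulr0 mul0r addr0.
rewrite big_nat_recl// mulrDr opprD.
have -> : n%:R * ((-1) ^+ (n - 0) * (stirling1 n 0)%:R * x%:R ^+ 0) = 0 :> R.
  by case: n {IHn} => [|n]; rewrite ?mul0r//= mulr0 mul0r mulr0.
rewrite oppr0 add0r mulr_sumr -sumrN; apply: eq_big_nat => p /= pn.
by rewrite -(subSS p n) subSn// natrM (exprS (-1)); ring.
Qed.

(** * Moments of the hypergeometric distribution *)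

(** Absorption, k C(w, k) = w C(w-1, k-1), lowers [m], [w] and [j] together by one; Vandermonde's
    identity settles j = 0. *)
Lemma hypergeometric_ffact_sum (m w b j : nat) : (j <= m)%N ->
  (\sum_(k < m.+1) k ^_ j * ('C(w, k) * 'C(b, m - k)) =
   w ^_ j * 'C(w + b - j, m - j))%N.
Proof.
elim: j m w => [|j IHj] m w.
  by under eq_bigr do rewrite mul1n; rewrite !subn0 mul1n binomial.Vandermonde.
case: m => // m jm; rewrite big_ord_recl /= mul0n add0n.
case: w => [|w]; first by apply: big1 => i _; rewrite /= muln0.
rewrite subSS addSn subSS ffactSS -mulnA -IHj// big_distrr /=.
apply: eq_bigr => k _; rewrite /bump /= add1n subSS ffactSS.
by rewrite mulnCA [RHS]mulnCA (mulnA w.+1) (mul_bin_diag w.+1 k); ring.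
Qed.

(** Both sides equal N! / (j! (m-j)! (N-m)!): they count pairs of nested subsets of sizes j and
    m. *)
Lemma mul_bin_sub (N m j : nat) : (j <= m)%N -> (m <= N)%N ->
  ('C(N - j, m - j) * 'C(N, j) = 'C(N, m) * 'C(m, j))%N.
Proof.
move=> jm mN; have jN := leq_trans jm mN.
have := bin_fact mN; have := bin_fact jm; have := bin_fact jN.
have := bin_fact (leq_sub2r j mN); rewrite subnBA// subnK//.
have := fact_gt0 j; have := fact_gt0 (m - j); have := fact_gt0 (N - m).
set a := j`!; set b := (m - j)`!; set d := (N - m)`!.
move=> d0 b0 a0 e1 e2 e3 e4.
apply/eqP; rewrite -(@eqn_pmul2r (a * b * d)) ?muln_gt0 ?a0 ?b0//; apply/eqP.
have -> : ('C(N - j, m - j) * 'C(N, j) * (a * b * d) =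
  'C(N, j) * (a * ('C(N - j, m - j) * (b * d))))%N by ring.
rewrite e1 e2 -e4 -e3; ring.
Qed.

Lemma hypergeometric_ffact_moment (R : realType) (m w b j : nat) :
  (m <= w + b)%N ->
  \sum_(k < m.+1) hypergeometric R m w b k * (k ^_ j)%:R =
  (w ^_ j)%:R * ('C(m, j)%:R / 'C(w + b, j)%:R).
Proof.
move=> mT.
(* For j > m both sides are 0: k <= m < j kills k^_j, and C(m, j) = 0. *)
have [jm|mj] := leqP j m; last first.
  rewrite bin_small// mul0r mulr0 big1// => k _.
  by rewrite ffact_small ?mulr0// (leq_trans _ mj).
under eq_bigr => k _ do rewrite mulrC /hypergeometric mulrA -natrM.
rewrite -mulr_suml -natr_sum hypergeometric_ffact_sum// natrM -mulrA; congr (_ * _).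
apply/eqP; rewrite eqr_div ?pnatr_eq0 -?lt0n ?bin_gt0// ?(leq_trans jm)//.
by rewrite -!natrM mul_bin_sub// mulnC.
Qed.

Lemma hypergeometric_affine_moment (R : realType) (m w b c s : nat) :
  (m <= w + b)%N ->
  \sum_(k < m.+1) hypergeometric R m w b k * (w + c * k)%:R ^+ s =
  \sum_(0 <= l < s.+1) 'C(s, l)%:R * c%:R ^+ l * w%:R ^+ (s - l) *
    \sum_(0 <= j < l.+1) (stirling2 l j)%:R *
      ((w ^_ j)%:R * ('C(m, j)%:R / 'C(w + b, j)%:R)).
Proof.
move=> mT.
under eq_bigr => k _.
  rewrite natrD exprDn_comm; last exact: mulrC.
  rewrite -(big_mkord xpredT (fun l => _ ^+ (s - l) * _ ^+ l *+ 'C(s, l))).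
  rewrite mulr_sumr; over.
rewrite exchange_big /=; apply: eq_bigr => l _.
have powE k : (k%:R : R) ^+ l =
    \sum_(0 <= j < l.+1) (stirling2 l j)%:R * (k ^_ j)%:R.
  rewrite -natrX expn_stirling2 natr_sum.
  by apply: eq_bigr => j _; rewrite natrM.
transitivity ('C(s, l)%:R * c%:R ^+ l * w%:R ^+ (s - l) *
   \sum_(k < m.+1) \sum_(0 <= j < l.+1) (stirling2 l j)%:R *
     (hypergeometric R m w b k * (k ^_ j)%:R)).
  rewrite mulr_sumr; apply: eq_bigr => k _.
  under [X in _ = _ * X]eq_bigr do rewrite mulrCA.
  by rewrite -mulr_sumr -powE natrM exprMn -mulr_natl; ring.
rewrite exchange_big /=; congr (_ * _); apply: eq_bigr => j _.
by rewrite -mulr_sumr hypergeometric_ffact_moment.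
Qed.

(** * Collecting powers of the number of white balls *)

(** Both sides range over a <= p <= j < n. Used with a = 0 for the two Stirling indices and with a =
    2 for the indices l and i of [beta]. *)
Lemma exchange_triangle (V : nmodType) (a n : nat) (F : nat -> nat -> V) :
  \sum_(0 <= j < n) \sum_(a <= p < j.+1) F j p =
  \sum_(a <= p < n) \sum_(p <= j < n) F j p.
Proof.
transitivity (\sum_(0 <= j < n) \sum_(a <= p < n | (p < j.+1)%N) F j p).
  by apply: eq_big_nat => j /= jn; rewrite (big_nat_widen _ _ _ _ _ jn).
rewrite (exchange_big_dep_nat xpredT)//=; apply: eq_bigr => p _.
by rewrite [RHS](big_nat_widenl _ 0)//; apply: eq_bigl => j; rewrite ltnS.
Qed.

(** Expand x^_j in powers x^p and collect by p. Only j = l contributes to x^l, with coefficient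
    [a l]; the lower powers are indexed by i = l + 1 - p. In the application [a j] is C(m, j) /
    C(T_n, j). *)
Lemma stirling2_ffact_sum (R : comPzRingType) (x l : nat) (a : nat -> R) :
  \sum_(0 <= j < l.+1) (stirling2 l j)%:R * ((x ^_ j)%:R * a j) =
  a l * x%:R ^+ l +
  \sum_(2 <= i < l.+1) x%:R ^+ (l + 1 - i) *
    \sum_(l + 1 - i <= j < l.+1) (-1) ^+ (j + i - 1 - l) *
      ((stirling2 l j * stirling1 j (l + 1 - i))%:R * a j).
Proof.
transitivity (\sum_(0 <= p < l.+1) x%:R ^+ p * \sum_(p <= j < l.+1)
    (-1) ^+ (j - p) * ((stirling2 l j * stirling1 j p)%:R * a j)).
  under eq_bigr => j _ do rewrite ffact_stirling1 mulrCA mulr_suml.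
  rewrite exchange_triangle; apply: eq_bigr => p _.
  by rewrite mulr_sumr; apply: eq_bigr => j _; rewrite natrM; ring.
rewrite big_nat_recr//= big_nat1 subnn mul1r stirling1nn stirling2nn mul1r addrC.
rewrite mulrC; congr (_ + _).
case: l => [|l]; first by rewrite !big_geq.
(* The constant term p = 0 vanishes for positive l, since S(l, 0) = 0 and c(j, 0) = 0 for j > 0. *)
rewrite big_ltn// big1_seq ?mulr0 ?add0r; last first.
  by case=> [|j] _ /=; rewrite ?muln0 ?mul0n mul0r mulr0.
rewrite big_nat_rev [RHS]big_add1 /=; apply: eq_big_nat => i /andP[i1 il].
rewrite (_ : 1 + l.+1 - i.+1 = l.+1 + 1 - i.+1)%N; last by lia.
congr (_ * _); apply: eq_big_nat => j /andP[j1 jl].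
by congr (_ ^+ _ * _); lia.
Qed.

(** The factor of the moment of order s + 1 - i in [beta]. Being independent of the history, it can
    be pulled out when averaging. *)
Definition beta_coef (R : realType) (m c W0 B0 n s i : nat) : R :=
  \sum_(i <= l < s.+1) 'C(s, l)%:R * c%:R ^+ l *
    \sum_(l + 1 - i <= j < l.+1)
      (-1) ^+ (j + i - 1 - l) *
      ((stirling2 l j * stirling1 j (l + 1 - i) * 'C(m, j))%:R /
       'C(total m c W0 B0 n, j)%:R).

(** The s-th moment after one more draw from a fixed composition. The factor w^(s-l) turns the
    leading w^l into w^s and each w^(l+1-i) into w^(s+1-i), an exponent free of l, so the sum over l
    can be done inside. *)
Lemma hypergeometric_moment_alpha_beta (R : realType)
    (m c W0 B0 n s w b : nat) :
  (m <= w + b)%N -> (w + b)%N = total m c W0 B0 n ->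
  \sum_(k < m.+1) hypergeometric R m w b k * (w + c * k)%:R ^+ s =
  alpha R m c W0 B0 n s * w%:R ^+ s +
  \sum_(2 <= i < s.+1) w%:R ^+ (s + 1 - i) * beta_coef R m c W0 B0 n s i.
Proof.
move=> mT TE; rewrite hypergeometric_affine_moment// TE.
under eq_bigr do rewrite stirling2_ffact_sum mulrDr mulr_sumr.
rewrite big_split /= exchange_triangle; congr (_ + _).
  rewrite /alpha mulr_suml; apply: eq_big_nat => l /= ls.
  rewrite (_ : w%:R ^+ s = w%:R ^+ (s - l) * w%:R ^+ l); last by rewrite -exprD subnK.
  by rewrite natrM; ring.
apply: eq_big_nat => i /andP[i2 _]; rewrite /beta_coef mulr_sumr.
apply: eq_big_nat => l /andP[il ls].
rewrite (_ : s + 1 - i = (s - l) + (l + 1 - i))%N; last by lia.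
under [in RHS]eq_bigr => j _ do rewrite natrM -mulrA.
by rewrite exprD; ring.
Qed.

(** * Urn size, positivity of alpha, and linear recurrences *)

Lemma urn_total (m c W0 B0 n : nat) (h : nat -> nat) :
  (forall i, (i < n)%N -> (h i <= m)%N) ->
  (white c W0 h n + black m c B0 h n)%N = total m c W0 B0 n.
Proof.
move=> hm; rewrite /white /black /total addnACA -big_split /=; congr addn.
under eq_bigr => i _ do rewrite -mulnDr subnKC ?hm//.
by rewrite sum_nat_const card_ord -mulnA (mulnC c).
Qed.

(** The term l = 0 is 1 and the others are nonnegative. *)
Lemma alpha_gt0 (R : realType) (m c W0 B0 n s : nat) :
  0 < alpha R m c W0 B0 n s.
Proof.
rewrite /alpha big_ltn// !bin0 mulr1 divr1 ltr_wpDr//.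
by apply: sumr_ge0 => l _; rewrite !mulr_ge0 ?exprn_ge0 ?invr_ge0.
Qed.

Lemma affine_recurrence (F : fieldType) (a b u : nat -> F) :
  (forall n, a n != 0) -> (forall n, u n.+1 = a n * u n + b n) ->
  forall n, u n = (\prod_(0 <= j < n) a j) *
    (u 0 + \sum_(0 <= l < n) b l / \prod_(0 <= j < l.+1) a j).
Proof.
move=> a0 uS; elim=> [|n IHn]; first by rewrite !big_geq// mul1r addr0.
have A0 : \prod_(0 <= j < n.+1) a j != 0
  by rewrite prodf_seq_neq0; apply/allP => j _; rewrite a0.
(* The last summand times the full product is exactly [b n]. *)
rewrite [X in _ * (_ + X)]big_nat_recr//= addrA [RHS]mulrDr mulrCA divff// mulr1.
by rewrite big_nat_recr//= uS {1}IHn; ring.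
Qed.

(** * From expectations to finite sums over histories *)

(** The integrand is the sum of [f j] times the indicator of the fibre over [j]; nonnegativity lets
    the integral pass through the sum without integrability conditions. *)
Lemma expectation_finite_range (d : measure_display) (T : measurableType d)
    (R : realType)
    (P : probability T R) (J : finType) (H : T -> J) (f : J -> R) :
  (forall j, measurable (H @^-1` [set j])%classic) -> (forall j, 0 <= f j) ->
  'E_P[(fun t => f (H t))]%E =
  (\sum_j f j * fine (P (H @^-1` [set j])%classic))%:E.
Proof.
move=> mH f0; rewrite expectation.unlock.
transitivity (\int[P]_t \sum_j
    ((f j)%:E * (\1_(H @^-1` [set j])%classic t)%:E))%E.
  apply: eq_integral => t _.
  rewrite (bigD1 (H t))//= big1 => [|j jH]; rewrite indicE.
    by rewrite adde0 mem_set//= mule1.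
  by rewrite memNset ?mule0//= => e; rewrite e eqxx in jH.
have mi j : measurable_fun setT
    (EFin \o (\1_(H @^-1` [set j])%classic : T -> R)).
  exact/measurable_EFinP/measurable_indic.
rewrite ge0_integral_sum//=; last 2 first.
- by move=> j; exact: measurable_funeM (mi j).
- by move=> j t _; rewrite mule_ge0// lee_fin.
rewrite -sumEFin; apply: eq_bigr => j _.
rewrite (ge0_integralZl_EFin _ measurableT _ (mi j))//=.
by rewrite integral_indic// setIT EFinM fineK// fin_num_measure.
Qed.

Section urn.
Context d (T : measurableType d) (R : realType) (P : probability T R).
Variables (m c W0 B0 : nat) (K : nat -> {RV P >-> nat}).
Hypothesis hK : urn_process m c W0 B0 K.

(* A finite history as a function on nat, the form expected by [history],
   [white] and [black]; its values beyond n are irrelevant. *)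
Definition extend (n : nat) (f : {ffun 'I_n -> 'I_m.+1}) (i : nat) : nat :=
  if insub i is Some j then f j else 0%N.

(** The first n draws as a point of a finite type; [inord] loses nothing because each draw is at
    most m. *)
Definition past (n : nat) (t : T) : {ffun 'I_n -> 'I_m.+1} :=
  [ffun i => inord (K (nat_of_ord i) t)].

Lemma extend_past n t i : (i < n)%N -> extend (past n t) i = K i t.
Proof.
by move=> ni; rewrite /extend insubT ffunE inordK// ltnS; apply: hK.1.
Qed.

Lemma extend_le n (f : {ffun 'I_n -> 'I_m.+1}) i : (extend f i <= m)%N.
Proof. by rewrite /extend; case: insub => // j; rewrite -ltnS. Qed.

Lemma preimage_past n f :
  (past n @^-1` [set f])%classic = history K n (extend f).
Proof.
apply/seteqP; split => t /=.
  by move=> <- i ni; rewrite extend_past.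
move=> Kf; apply/ffunP => i; rewrite ffunE Kf// /extend.
by rewrite valK inord_val.
Qed.

Lemma measurable_draw n k : measurable [set t | K n t = k].
Proof.
rewrite -[X in measurable X]/(K n @^-1` [set k])%classic.
exact: measurable_funPTI.
Qed.

Lemma measurable_history n h : measurable (history K n h).
Proof.
rewrite (_ : history K n h = \bigcap_(i in `I_n) [set t | K i t = h i])%classic//.
by apply: fin_bigcap_measurable => // i _; exact: measurable_draw.
Qed.

Lemma white_extend_past n t :
  white c W0 (extend (past n t)) n = white_after c W0 K n t.
Proof.
by congr addn; apply: eq_bigr => i _; rewrite extend_past.
Qed.

Lemma moment_white_past n s : moment P (white_after c W0 K n) s =
  (\sum_(f : {ffun 'I_n -> 'I_m.+1})
     (white c W0 (extend f) n)%:R ^+ s * fine (P (history K n (extend f))))%:E.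
Proof.
rewrite /moment.
under eq_fun do rewrite -white_extend_past.
rewrite (expectation_finite_range P (H := past n)
  (f := fun f => (white c W0 (extend f) n)%:R ^+ s)).
- by congr (_%:E); apply: eq_bigr => f _; rewrite preimage_past.
- by move=> f; rewrite preimage_past; apply: measurable_history.
- by move=> f; rewrite exprn_ge0.
Qed.

Lemma prob_draw_history n h k : (k <= m)%N ->
  fine (P ([set t | K n t = k] `&` history K n h)%classic) =
  hypergeometric R m (white c W0 h n) (black m c B0 h n) k *
    fine (P (history K n h)).
Proof.
(* On a null history the urn law says nothing, but both sides are 0 by monotonicity. *)
move=> km; have [P0|P0] := eqVneq (P (history K n h)) 0%E.
  rewrite P0 mulr0 (_ : P _ = 0%E)//; apply/eqP; rewrite -measure_le0 -P0.
  apply: le_measure; rewrite ?inE; [|exact: measurable_history|exact: subIsetr].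
  by apply: measurableI; [exact: measurable_draw|exact: measurable_history].
rewrite -hK.2// /cond_prob divfK// fine_eq0// fin_num_measure//.
exact: measurable_history.
Qed.

(** * The moment recurrence and its solution *)

Lemma moment_white_recr (n s : nat) : (m <= W0 + B0)%N ->
  fine (moment P (white_after c W0 K n.+1) s) =
  alpha R m c W0 B0 n s * fine (moment P (white_after c W0 K n) s) +
  beta m c W0 B0 K n s.
Proof.
(* [H] records the first n draws and the next one; [g] is the s-th power of the resulting white
   count, read off from [H]. *)
move=> mWB; pose H t := (past n t, inord (K n t) : 'I_m.+1).
pose g (fk : {ffun 'I_n -> 'I_m.+1} * 'I_m.+1) : R :=
  (white c W0 (extend fk.1) n + c * fk.2)%:R ^+ s.
have HE f k : (H @^-1` [set (f, k)])%classic =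
    ([set t | K n t = k] `&` history K n (extend f))%classic.
  rewrite -preimage_past; apply/seteqP; split => t /=.
    by case=> -> <-; rewrite inordK// ltnS; apply: hK.1.
  by case=> Kk <-; rewrite /H Kk inord_val.
have -> : moment P (white_after c W0 K n.+1) s =
    (\sum_fk g fk * fine (P (H @^-1` [set fk])%classic))%:E.
  rewrite -expectation_finite_range//; last first.
  - by move=> fk; rewrite exprn_ge0.
  - move=> [f k]; rewrite HE; apply: measurableI.
      exact: measurable_draw.
    exact: measurable_history.
  rewrite /moment; congr ('E_P[_])%E; apply/funext => t.
  rewrite /g /= white_extend_past inordK; last by rewrite ltnS; apply: hK.1.
  by rewrite /white_after /white big_ord_recr /= addnA.
rewrite moment_white_past /=.
transitivity (\sum_f \sum_k g (f, k) * fine (P (H @^-1` [set (f, k)])%classic)).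
  by rewrite pair_bigA; apply: eq_bigr => -[].
transitivity (\sum_(f : {ffun 'I_n -> 'I_m.+1})
   (alpha R m c W0 B0 n s * (white c W0 (extend f) n)%:R ^+ s +
    \sum_(2 <= i < s.+1) (white c W0 (extend f) n)%:R ^+ (s + 1 - i) *
      beta_coef R m c W0 B0 n s i) * fine (P (history K n (extend f)))).
  (* For a fixed history the next draw is hypergeometric, and the urn holds T_n >= T_0 >= m
     balls. *)
  apply: eq_bigr => f _.
  have TE := urn_total c W0 B0 (fun i _ => extend_le f i) (n := n).
  rewrite -(hypergeometric_moment_alpha_beta _ _ _ TE); last first.
    by rewrite TE /total (leq_trans mWB)// leq_addr.
  rewrite mulr_suml; apply: eq_bigr => k _.
  rewrite HE prob_draw_history; last by rewrite -ltnS.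
  by rewrite mulrCA mulrA.
(* Averaging over histories turns each power of the white count into a moment of W_n. *)
under [LHS]eq_bigr do rewrite mulrDl -mulrA mulr_suml.
rewrite big_split /= -mulr_sumr exchange_big /=; congr (_ + _).
apply: eq_bigr => i _; rewrite moment_white_past /= mulr_suml.
by apply: eq_bigr => f _; rewrite /beta_coef; ring.
Qed.

End urn.

Theorem theorem2 (d : measure_display) (T : measurableType d) (R : realType)
    (P : probability T R) (m c W0 B0 : nat) (K : nat -> {RV P >-> nat})
    (hm : (1 <= m)%N) (hc : (1 <= c)%N) (hW0 : (0 < W0)%N) (hB0 : (0 < B0)%N)
    (hT0 : (m <= W0 + B0)%N)
    (hK : urn_process m c W0 B0 K)
    (s n : nat) (hs : (1 <= s)%N) :
  moment P (white_after c W0 K n) s =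
  ((\prod_(0 <= j < n) alpha R m c W0 B0 j s) *
   (W0%:R ^+ s +
    \sum_(0 <= l < n)
      beta m c W0 B0 K l s / \prod_(0 <= j < l.+1) alpha R m c W0 B0 j s))%:E.
Proof.
have m0 : fine (moment P (white_after c W0 K 0) s) = W0%:R ^+ s.
  rewrite /moment (_ : (fun t => _) = cst (W0%:R ^+ s)) ?expectation_cst//.
  by apply/funext => t; rewrite /white_after /white big_ord0 addn0.
(* The moment is a finite sum, hence finite, so the identity reduces to one between reals. *)
rewrite -[LHS]fineK; last by rewrite (moment_white_past hK).
rewrite -m0; congr (_%:E).
apply: (affine_recurrence (a := fun n => alpha R m c W0 B0 n s)
  (b := fun n => beta m c W0 B0 K n s)
  (u := fun n => fine (moment P (white_after c W0 K n) s))) => j.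
  by rewrite gt_eqF// alpha_gt0.
exact: (moment_white_recr hK).
Qed.
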